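(* Let $n\ge 2$. (i) Let $r(z,\bar z)$ be a real polynomial on $\mathbb{C}^n$, not identically zero, such that $r(z,\bar z)\,\|z\|^2$ is a squared norm, and let $(N_+,N_-)$ be the signature pair of $r$. Then $$\frac{N_-}{N_+}<n-1.$$ (ii) The inequality in (i) is sharp: for every $\varepsilon>0$ there exists a real polynomial $r(z,\bar z)$ on $\mathbb{C}^n$, not identically zero, such that $r(z,\bar z)\,\|z\|^2$ is a squared norm and whose signature pair $(N_+,N_-)$ satisfies $$\frac{N_-}{N_+}\ge n-1-\varepsilon .$$
   Context: A real polynomial on $\mathbb{C}^n$ is a real-valued polynomial $r(z,\bar z)=\sum_{\alpha,\beta}c_{\alpha\beta}z^\alpha\bar z^\beta$ in $z$ and $\bar z$, where $z\in\mathbb{C}^n$ (so the coefficient matrix $(c_{\alpha\beta})$ is Hermitian). Here $\|z\|^2=\sum_{k=1}^n|z_k|^2$. A squared norm (also called a Hermitian sum of squares) is a polynomial of the form $\|f(z)\|^2=\sum_{j=1}^N|f_j(z)|^2$ with finitely many holomorphic polynomials $f_j$ (that is, $f_j\in\mathbb{C}[z_1,\dots,z_n]$). Every real polynomial can be written as $r(z,\bar z)=\sum_{j=1}^{N_+}|f_j(z)|^2-\sum_{j=1}^{N_-}|g_j(z)|^2$ with holomorphic polynomials $f_j,g_j$; when $f_1,\dots,f_{N_+},g_1,\dots,g_{N_-}$ are linearly independent, the pair $(N_+,N_-)$ is uniquely determined by $r$ and is called the signature pair of $r$. Equivalently, $N_+$ and $N_-$ are the numbers of positive and negative eigenvalues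 of the Hermitian coefficient matrix $(c_{\alpha\beta})$. *)

(* Defs.v *)
From HB Require Import structures.
From mathcomp Require Import all_boot all_order all_algebra.
From mathcomp Require Import reals complex mpoly.

Set Implicit Arguments.
Unset Strict Implicit.
Unset Printing Implicit Defensive.

Import Order.TTheory GRing.Theory Num.Theory.
Local Open Scope ring_scope.

(* A polynomial r(z, \bar z) on C^n is encoded by an element of
   {mpoly R[i][n + n]}: the first n indeterminates stand for z_1, ..., z_n and
   the last n for their conjugates. *)
Definition zzbar (R : realType) (n : nat) (z : 'I_n -> R[i]) :
    'I_(n + n) -> R[i] :=
  fun k => match split k with inl i => z i | inr i => Num.conj (z i) end.

Definition bieval (R : realType) (n : nat) (r : {mpoly R[i][n + n]})
    (z : 'I_n -> R[i]) : R[i] := r.@[zzbar z].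

Definition real_polynomial (R : realType) (n : nat)
    (r : {mpoly R[i][n + n]}) : Prop :=
  forall z : 'I_n -> R[i], bieval r z \is Num.real.

Definition sqnorm (R : realType) (n : nat) (z : 'I_n -> R[i]) : R[i] :=
  \sum_(k < n) `|z k| ^+ 2.

Definition sqnorm_poly (R : realType) (n N : nat)
    (f : 'I_N -> {mpoly R[i][n]}) (z : 'I_n -> R[i]) : R[i] :=
  sqnorm (fun j => (f j).@[z]).

Definition squared_norm (R : realType) (n : nat)
    (F : ('I_n -> R[i]) -> R[i]) : Prop :=
  exists (N : nat) (f : 'I_N -> {mpoly R[i][n]}), F =1 sqnorm_poly f.

(* Linear independence over C of the concatenated family
   f_1, ..., f_p, g_1, ..., g_q; {mpoly _} is not a vectType, so the
   library predicate [free] does not apply. *)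
Definition lin_indep2 (R : realType) (n p q : nat)
    (f : 'I_p -> {mpoly R[i][n]}) (g : 'I_q -> {mpoly R[i][n]}) : Prop :=
  forall (a : 'I_p -> R[i]) (b : 'I_q -> R[i]),
    \sum_(j < p) a j *: f j + \sum_(j < q) b j *: g j = 0 ->
    (forall j, a j = 0) /\ (forall j, b j = 0).

Definition signature_pair (R : realType) (n : nat)
    (r : {mpoly R[i][n + n]}) (Np Nm : nat) : Prop :=
  exists (f : 'I_Np -> {mpoly R[i][n]}) (g : 'I_Nm -> {mpoly R[i][n]}),
    lin_indep2 f g /\
    forall z, bieval r z = sqnorm_poly f z - sqnorm_poly g z.

(* Main.v *)
Require Import Defs.
From mathcomp Require Import all_boot all_order all_algebra.
From mathcomp Require Import reals complex mpoly.
From mathcomp Require Import zify ring lra.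

Set Implicit Arguments.
Unset Strict Implicit.
Unset Printing Implicit Defensive.

Import Order.TTheory GRing.Theory Num.Theory.
Local Open Scope ring_scope.

(* (i) Write [r = ||f||^2 - ||g||^2] and [r ||z||^2 = ||h||^2].  Then
   [||z (x) f||^2 = ||z (x) g||^2 + ||h||^2], and after polarization this forces
   every [z_k g_j] into the span of the [z_k f_i].  So if [W] is the span of the
   [f_i] and [g_j], of dimension N+ + N-, the space [sum_k z_k W] has dimension at
   most n N+.  It contains [z_0 W] and [z_1 W], which differ when [W <> 0] because
   the lowest order in [z_0] is larger on the former; hence N+ + N- < n N+.

   (ii) Take [r = sum_a c_a |z^a|^2] over the exponents [a] of a box [0, d]^n.
   The coefficient of [|z^b|^2] in [r ||z||^2] is the sum of [c_a] over the
   [a = b - e_k] in the box.  Let [c_a = n^2] if [a] is on the boundary of the box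
   or [sum_i i a_i = c] mod n, and [c_a = -1] otherwise.  When all the [b - e_k] are
   in the box, these weights run through all residues mod n, so one of the [n]
   terms is [n^2]; otherwise all the terms lie on the boundary.  For a suitable
   [c] about one interior exponent in n is positive, and the boundary is negligible
   for large [d]. *)

(** * Polynomials vanishing on the anti-diagonal *)

Lemma poly_natr_eq0 (K : numDomainType) (p : {poly K}) :
  (forall k : nat, p.[k%:R] = 0) -> p = 0.
Proof.
move=> p0; apply/eqP; apply: contraT => p_neq0.
have := max_poly_roots (rs := [seq k%:R | k <- iota 0 (size p)]) p_neq0.
rewrite size_map size_iota ltnn; apply.
  by apply/allP => _ /mapP[k _ ->]; rewrite rootE p0.
by rewrite map_inj_uniq ?iota_uniq //; apply: mulrIn; rewrite oner_eq0.
Qed.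

Section Muni.
Variables (K : numDomainType) (n : nat).
Implicit Type p : {mpoly K[n.+1]}.

Lemma meval_muni p (x : 'I_n.+1 -> K) :
  p.@[x] = (map_poly (meval (x \o widen_ord (leqnSn n))) (muni p)).[x ord_max].
Proof.
rewrite muniE mevalE raddf_sum /= horner_sum; apply: eq_bigr => m _.
rewrite -mul_polyC rmorphM /= map_polyC map_polyXn !hornerE /=.
rewrite mevalZ mevalX big_ord_recr /= mulrA; congr (_ * _ * _).
by apply: eq_bigr => i _; rewrite mnmE.
Qed.

Lemma mcoeff_muni p (m : 'X_{1..n.+1}) :
  (muni p)`_(m ord_max)@_[multinom m (widen_ord (leqnSn n) i) | i < n] = p@_m.
Proof.
rewrite muniE coef_sum raddf_sum /=.
rewrite [p in RHS]mpolyE [RHS]raddf_sum /=; apply: eq_bigr => m' _.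
rewrite [RHS]mcoeffZ mcoeffX.
rewrite coefZ coefXn -scalerAl mcoeffZ; congr (_ * _).
have [->|neq] := eqVneq m' m; first by rewrite !eqxx mulr1 mcoeffX eqxx.
have [eq_max|_] := eqVneq (m ord_max) (m' ord_max); last by rewrite mulr0 mcoeff0.
rewrite mulr1 mcoeffX; case: eqP => // eq_w; case/eqP: neq.
apply/mnmP => i; have [->//|] := eqVneq i ord_max.
move=> i_max; have lt_i : (i < n)%N.
  by rewrite ltn_neqAle -ltnS ltn_ord andbT; apply: contraNneq i_max => ei;
    apply/eqP/val_inj.
have := congr1 (fun m : 'X_{1..n} => m (Ordinal lt_i)) eq_w.
by rewrite !mnmE; congr (_ = _); congr (fun_of_multinom _ _); apply: val_inj.
Qed.
End Muni.

(** Induction on the number of variables: with naturals put in the first ones, [muni p] becomes a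
    univariate polynomial in the last variable that vanishes at every natural. Natural points are
    convenient because conjugation fixes them. *)
Lemma mpoly_natr_eq0 (K : numDomainType) (n : nat) (p : {mpoly K[n]}) :
  (forall k : 'I_n -> nat, p.@[fun i => (k i)%:R] = 0) -> p = 0.
Proof.
elim: n p => [|n IHn] p p0.
  apply/mpolyP => m; rewrite mcoeff0 nvar0_mnmE.
  have := p0 (fun=> 0%N).
  by rewrite [p]nvar0_mpolyC mevalC mcoeffC eqxx mulr1.
have q0 j : (muni p)`_j = 0.
  apply: IHn => k; rewrite -coef_map /= [map_poly _ _](_ : _ = 0) ?coef0 //.
  apply: poly_natr_eq0 => l.
  (* [k'] extends [k] by the value [l] at the last index. *)
  pose k' (i : 'I_n.+1) := if insub (val i) is Some i' then k i' else l.
  have := p0 k'; rewrite meval_muni.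
  rewrite (_ : k' ord_max = l); last by rewrite /k' insubF //= ltnn.
  congr (_.[_] = _); apply: eq_map_poly => q; apply: meval_eq => i /=.
  by rewrite /k' /= (valK i).
by apply/mpolyP => m; rewrite -mcoeff_muni q0 !mcoeff0.
Qed.

Lemma mpoly_meval_eq (K : numDomainType) (n : nat) (p q : {mpoly K[n]}) :
  (forall x, p.@[x] = q.@[x]) -> p = q.
Proof.
move=> pq; apply/subr0_eq/mpoly_natr_eq0 => k.
by rewrite mevalB pq subrr.
Qed.

Lemma meval_map_mpoly (A B : comNzRingType) (f : {rmorphism A -> B}) (n : nat)
    (p : {mpoly A[n]}) (x : 'I_n -> A) :
  (map_mpoly f p).@[f \o x] = f p.@[x].
Proof.
elim/mpolyind: p => [|c m p _ _ IH]; first by rewrite !raddf0.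
rewrite !raddfD /= IH map_mpolyZ map_mpolyX !mevalZ !mevalX rmorphM rmorph_prod.
by congr (_ * _ + _); apply: eq_bigr => i _; rewrite /= rmorphXn.
Qed.

(** * Polarization of equalities between squared norms *)

Section Polarization.
Variable C : numClosedFieldType.

Variable n : nat.

Definition zwpoint (z w : 'I_n -> C) : 'I_(n + n) -> C :=
  fun k => match split k with inl i => z i | inr i => w i end.

Lemma zwpointK (x : 'I_(n + n) -> C) :
  zwpoint (x \o @lshift n n) (x \o @rshift n n) =1 x.
Proof.
by move=> k; rewrite /zwpoint -{2}[k]splitK; case: (split k).
Qed.

(* [z = x + i y] and [w = x - i y] with [x], [y] ranging over the real points
   parametrize the anti-diagonal [w = \bar z]. *)
Lemma meval_conj_eq0 (P : {mpoly C[n + n]}) :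
  (forall z : 'I_n -> C, P.@[zwpoint z (Num.conj \o z)] = 0) -> P = 0.
Proof.
move=> P0.
pose X i : {mpoly C[n + n]} := 'X_(lshift n i).
pose Y i : {mpoly C[n + n]} := 'X_(rshift n i).
pose L (k : 'I_(n + n)) : {mpoly C[n + n]} :=
  match split k with inl i => X i + 'i *: Y i | inr i => X i - 'i *: Y i end.
have LE v : (P \mPo [tuple L k | k < n + n]).@[v] =
    P.@[zwpoint (fun i => v (lshift n i) + 'i * v (rshift n i))
                (fun i => v (lshift n i) - 'i * v (rshift n i))].
  rewrite comp_mpoly_meval; apply: meval_eq => k; rewrite tnth_mktuple /L /zwpoint.
  by case: (split k) => i; rewrite ?mevalB ?mevalD ?mevalN mevalZ !mevalXU.
have Q0 : P \mPo [tuple L k | k < n + n] = 0.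
  apply: mpoly_natr_eq0 => k; rewrite LE.
  rewrite -[RHS](P0 (fun i => (k (lshift n i))%:R + 'i * (k (rshift n i))%:R)).
  apply: meval_eq => j; rewrite /zwpoint; case: (split j) => i //=.
  by rewrite rmorphD rmorphM /= conjCi !rmorph_nat mulNr.
apply: mpoly_meval_eq => x; rewrite meval0.
(* [v] inverts the substitution [L], so the vanishing of the composite gives that of [P] at an
   arbitrary [x]. *)
pose v := zwpoint (fun i => (x (lshift n i) + x (rshift n i)) / 2)
                  (fun i => (x (lshift n i) - x (rshift n i)) / (2 * 'i)).
have := LE v; rewrite Q0 meval0 => /esym E; rewrite -[RHS]E.
apply: meval_eq => k; rewrite -[LHS]zwpointK /zwpoint.
have vl i : v (lshift n i) = (x (lshift n i) + x (rshift n i)) / 2.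
  by rewrite /v /zwpoint (unsplitK (inl i)).
have vr i : v (rshift n i) = (x (lshift n i) - x (rshift n i)) / (2 * 'i).
  by rewrite /v /zwpoint (unsplitK (inr i)).
have i0 : 'i != 0 :> C by apply: neq0Ci.
have two0 : 2 != 0 :> C by rewrite pnatr_eq0.
by case: (split k) => i /=; rewrite vl vr; field; rewrite ?i0 ?two0.
Qed.

Definition holo (F : {mpoly C[n]}) : {mpoly C[n + n]} :=
  F \mPo [tuple 'X_(lshift n i) | i < n].
(** The coefficients are conjugated so that substituting the conjugate of w yields the conjugate of
    F(w). *)
Definition antiholo (F : {mpoly C[n]}) : {mpoly C[n + n]} :=
  map_mpoly Num.conj F \mPo [tuple 'X_(rshift n i) | i < n].

Lemma meval_holo (F : {mpoly C[n]}) (z w : 'I_n -> C) :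
  (holo F).@[zwpoint z w] = F.@[z].
Proof.
rewrite comp_mpoly_meval; apply: meval_eq => i.
by rewrite tnth_mktuple mevalXU /zwpoint (unsplitK (inl i)).
Qed.

Lemma meval_antiholo (F : {mpoly C[n]}) (z w : 'I_n -> C) :
  (antiholo F).@[zwpoint z (Num.conj \o w)] = Num.conj F.@[w].
Proof.
rewrite comp_mpoly_meval -meval_map_mpoly; apply: meval_eq => i.
by rewrite tnth_mktuple mevalXU /zwpoint (unsplitK (inr i)).
Qed.

(** Both sides are polynomials in z and the conjugate of w, and they agree on the anti-diagonal by
    hypothesis. *)
Lemma polarization (I J : finType) (F : I -> {mpoly C[n]}) (G : J -> {mpoly C[n]}) :
  (forall z, \sum_i `|(F i).@[z]| ^+ 2 = \sum_j `|(G j).@[z]| ^+ 2) ->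
  forall z w, \sum_i (F i).@[z] * Num.conj (F i).@[w] =
              \sum_j (G j).@[z] * Num.conj (G j).@[w].
Proof.
pose P (T : finType) (H : T -> {mpoly C[n]}) := \sum_i holo (H i) * antiholo (H i).
have PE (T : finType) (H : T -> {mpoly C[n]}) z w :
    (P T H).@[zwpoint z (Num.conj \o w)] = \sum_i (H i).@[z] * Num.conj (H i).@[w].
  rewrite raddf_sum /=; apply: eq_bigr => i _.
  by rewrite mevalM meval_holo meval_antiholo.
move=> FG z w; rewrite -!PE; congr (_.@[_]); apply/subr0_eq/meval_conj_eq0 => x.
rewrite [LHS]mevalB !PE; apply/eqP; rewrite subr_eq0; apply/eqP.
by under eq_bigr do rewrite -normCK; under [RHS]eq_bigr do rewrite -normCK.
Qed.

Lemma polarization_coeff (I J : finType)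
    (F : I -> {mpoly C[n]}) (G : J -> {mpoly C[n]}) :
  (forall z, \sum_i `|(F i).@[z]| ^+ 2 = \sum_j `|(G j).@[z]| ^+ 2) ->
  forall a b, \sum_i (F i)@_a * Num.conj (F i)@_b =
              \sum_j (G j)@_a * Num.conj (G j)@_b.
Proof.
move=> /polarization FG a b.
have coefE (T : finType) (H : T -> {mpoly C[n]}) (x : T -> C) m :
    (\sum_i Num.conj (x i) *: H i)@_m = Num.conj (\sum_i x i * Num.conj (H i)@_m).
  rewrite !raddf_sum /=; apply: eq_bigr => i _.
  by rewrite mcoeffZ rmorphM /= conjCK.
have FGb w : \sum_i Num.conj (F i).@[w] *: F i = \sum_j Num.conj (G j).@[w] *: G j.
  apply: mpoly_meval_eq => z; rewrite !raddf_sum /=.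
  under eq_bigr do rewrite mevalZ mulrC.
  by under [RHS]eq_bigr do rewrite mevalZ mulrC.
(* The z^a coefficient of [FGb w] is the conjugate of a polynomial in w, so removing the conjugation
   leaves a polynomial identity whose b coefficient can be read off. *)
have FGa : \sum_i Num.conj (F i)@_a *: F i = \sum_j Num.conj (G j)@_a *: G j.
  apply: mpoly_meval_eq => w; rewrite !raddf_sum /=.
  have := congr1 (mcoeff a) (FGb w); rewrite !coefE => /(can_inj conjCK) E.
  under eq_bigr do rewrite mevalZ mulrC.
  by under [RHS]eq_bigr do rewrite mevalZ mulrC.
have := congr1 (mcoeff b) FGa; rewrite !coefE => /(can_inj conjCK).
exact.
Qed.
End Polarization.

(** * The bound on the signature *)

(** The coefficient matrices of [F] and [G] have the same Gram matrix, so they have the same kernel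
    on column vectors, hence the rows of one lie in the row space of the other. *)
Lemma span_of_sqnorm_eq (C : numClosedFieldType) (n : nat) (I J : finType)
    (F : I -> {mpoly C[n]}) (G : J -> {mpoly C[n]}) :
  (forall a b, \sum_i (F i)@_a * Num.conj (F i)@_b =
               \sum_j (G j)@_a * Num.conj (G j)@_b) ->
  forall j, exists c : I -> C, G j = \sum_i c i *: F i.
Proof.
move=> FG j.
(* [s] lists all monomials that occur, so that each polynomial becomes a finite row of
   coefficients. *)
pose s := flatten [seq msupp (F i) | i : I] ++ flatten [seq msupp (G i) | i : J].
have sF i m : m \notin s -> (F i)@_m = 0.
  rewrite mem_cat negb_or => /andP[+ _]; apply: contraNeq => Fm.
  by apply/flattenP; exists (msupp (F i)); [exact: codom_f | rewrite mcoeff_msupp].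
have sG i m : m \notin s -> (G i)@_m = 0.
  rewrite mem_cat negb_or => /andP[_]; apply: contraNeq => Gm.
  by apply/flattenP; exists (msupp (G i)); [exact: codom_f | rewrite mcoeff_msupp].
pose M (T : finType) (H : T -> {mpoly C[n]}) : 'M_(#|T|, size s) :=
  \matrix_(i, k) (H (enum_val i))@_(nth 0%MM s k).
pose star p q (A : 'M[C]_(p, q)) := (map_mx Num.conj A)^T.
have gram T H : star _ _ (M T H) *m M T H =
    \matrix_(k, l) \sum_i (H i)@_(nth 0%MM s l) * Num.conj (H i)@_(nth 0%MM s k).
  apply/matrixP => k l; rewrite !mxE (reindex (@enum_val T predT)) /=; last first.
    exact: onW_bij (enum_val_bij _).
  by apply: eq_bigr => i _; rewrite !mxE mulrC.
have gramE : star _ _ (M J G) *m M J G = star _ _ (M I F) *m M I F.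
  by rewrite !gram; apply/matrixP => k l; rewrite !mxE FG.
have /submxP[X XE] : (M J G <= M I F)%MS.
  rewrite submxE; set D := _ *m _.
  (* [D] is [M J G] applied to the kernel of [M I F]; the diagonal entries of its Gram matrix are
     sums of squared moduli, so their vanishing kills [D]. *)
  have DD : star _ _ D *m D = 0.
    rewrite /D /star map_mxM trmx_mul -!mulmxA (mulmxA _ (M J G)).
    by rewrite [_ *m M J G]gramE -mulmxA mulmx_coker !mulmx0.
  apply/eqP/matrixP => i k; rewrite [RHS]mxE; apply/eqP.
  have := congr1 (fun A : 'M_(_, _) => A k k) DD; rewrite !mxE.
  under eq_bigr do rewrite !mxE mulrC -normCK.
  move/psumr_eq0P => D0; have := D0 (fun _ _ => exprn_ge0 2 (normr_ge0 _)) i isT.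
  by move/eqP; rewrite expf_eq0 normr_eq0.
exists (fun i => X (enum_rank j) (enum_rank i)); apply/mpolyP => m.
rewrite raddf_sum /=; under eq_bigr do rewrite mcoeffZ.
have [ms|ms] := boolP (m \in s); last first.
  by rewrite sG // big1 // => i _; rewrite sF ?mulr0.
have lt_m : (index m s < size s)%N by rewrite index_mem.
have := congr1 (fun A : 'M_(_, _) => A (enum_rank j) (Ordinal lt_m)) XE.
rewrite !mxE enum_rankK /= nth_index // => ->.
rewrite (reindex (@enum_val I predT)) /=; last exact: onW_bij (enum_val_bij _).
by apply: eq_bigr => i _; rewrite !mxE enum_valK /= nth_index.
Qed.

(** The matrix [A] expressing [W] through [S] has independent rows and at most as many columns as
    rows, so it has a left inverse, which expresses [S] through [W]. *)
Lemma span_exchange (K : fieldType) (V : lmodType K) (I J : finType)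
    (W : I -> V) (S : J -> V) :
  (forall a : I -> K, \sum_i a i *: W i = 0 -> forall i, a i = 0) ->
  (forall i, exists c : J -> K, W i = \sum_j c j *: S j) ->
  (#|J| <= #|I|)%N ->
  forall j, exists c : I -> K, S j = \sum_i c i *: W i.
Proof.
move=> W_free /fin_all_exists[c cE] leJI j.
pose A : 'M[K]_(#|I|, #|J|) := \matrix_(i, l) c (enum_val i) (enum_val l).
have sumE (T : finType) (h : T -> V) : \sum_i h i = \sum_(i < #|T|) h (enum_val i).
  by rewrite (reindex (@enum_val T predT)) //; exact: onW_bij (enum_val_bij _).
have WE i : W (enum_val i) = \sum_l A i l *: S (enum_val l).
  by rewrite cE sumE; apply: eq_bigr => l _; rewrite mxE.
have AE (p : nat) (X : 'M[K]_(p, _)) r :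
    \sum_i X r i *: W (enum_val i) = \sum_l (X *m A) r l *: S (enum_val l).
  under eq_bigr do rewrite WE scaler_sumr.
  rewrite exchange_big; apply: eq_bigr => l _; rewrite mxE scaler_suml.
  by apply: eq_bigr => i _; rewrite scalerA.
have A_free : row_free A.
  apply: inj_row_free => v vA; apply/rowP => i; rewrite [RHS]mxE.
  have /W_free/(_ (enum_val i)) : \sum_i v ord0 (enum_rank i) *: W i = 0.
    rewrite sumE; under eq_bigr do rewrite enum_valK.
    by rewrite AE vA big1 // => l _; rewrite mxE scale0r.
  by rewrite enum_valK.
have /row_fullP[B BA] : row_full A.
  by rewrite /row_full eqn_leq rank_leq_col (leq_trans leJI) // (eqP A_free).
exists (fun i => B (enum_rank j) (enum_rank i)).
rewrite sumE; under eq_bigr do rewrite enum_valK.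
rewrite AE BA (bigD1 (enum_rank j)) //= mxE eqxx scale1r enum_rankK big1 ?addr0 //.
by move=> l; rewrite mxE eq_sym => /negbTE->; rewrite scale0r.
Qed.

Lemma mcoeffMX_eq0 (A : nzRingType) (n : nat) (p : {mpoly A[n]})
    (j : 'I_n) (m : 'X_{1..n}) :
  m j = 0%N -> (p * 'X_j)@_m = 0.
Proof.
move=> mj; rewrite mcoeffM big1 // => -[k l] /= /eqP mE.
rewrite mcoeffX; case: eqP => [lE|_]; last by rewrite mulr0.
by move: mj; rewrite (congr1 (fun m' : 'X_{1..n} => m' j) mE) -lE mnmDE mnm1E eqxx addn1.
Qed.

(* Otherwise the lowest order in 'X_j of the [W i] would drop by one. *)
Lemma shift_stable_eq0 (A : comNzRingType) (n : nat) (j k : 'I_n) (I : finType)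
    (W : I -> {mpoly A[n]}) :
  j != k ->
  (forall i, exists c : I -> A, W i * 'X_k = \sum_l c l *: (W l * 'X_j)) ->
  forall i, W i = 0.
Proof.
move=> neq_jk WX i.
suff W0 d : forall i (m : 'X_{1..n}), (m j < d)%N -> (W i)@_m = 0.
  by apply/mpolyP => m; rewrite mcoeff0 (W0 (m j).+1).
elim: d => // d IHd {}i m lt_m; have [c cE] := WX i.
rewrite -(mcoeffMX _ U_(k)%MM) cE raddf_sum big1 //= => l _; rewrite mcoeffZ.
have [m0|m_gt0] := posnP (m j).
  by rewrite mcoeffMX_eq0 ?mulr0 // mnmDE mnm1E eq_sym (negbTE neq_jk).
(* Dividing by 'X_j leaves an exponent whose j-th entry is m j - 1, which the induction hypothesis
   covers. *)
rewrite [(_ + m)%MM](_ : _ = U_(j) + (U_(k) + (m - U_(j))))%MM.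
  rewrite mcoeffMX IHd ?mulr0 // mnmDE mnmBE !mnm1E eq_sym (negbTE neq_jk) eqxx.
  by rewrite subn1 -ltnS prednK.
apply/mnmP => t; rewrite !mnmDE mnmBE !mnm1E.
by have [<-|_] := eqVneq j t; rewrite ?subn0 // addnCA subnKC.
Qed.

(** Otherwise the independent products [w i * 'X_j0] would be numerous enough to span all the [S p],
    hence all the [w i * 'X_j1]; by [shift_stable_eq0] every [w i] would vanish, against the
    independence of a nonempty family. *)
Lemma card_lt_of_mul_sqnorm (C : numClosedFieldType) (n Np Nm N : nat)
    (f : 'I_Np -> {mpoly C[n]}) (g : 'I_Nm -> {mpoly C[n]})
    (h : 'I_N -> {mpoly C[n]}) :
  (1 < n)%N -> (0 < Np + Nm)%N ->
  (forall a b, \sum_j a j *: f j + \sum_j b j *: g j = 0 ->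
     (forall j, a j = 0) /\ (forall j, b j = 0)) ->
  (forall z, (\sum_j `|(f j).@[z]| ^+ 2 - \sum_j `|(g j).@[z]| ^+ 2)
       * (\sum_k `|z k| ^+ 2) = \sum_j `|(h j).@[z]| ^+ 2) ->
  (Np + Nm < Np * n)%N.
Proof.
move=> n_gt1 N_gt0 fg_free fgh; rewrite ltnNge; apply/negP => le_N.
pose j0 : 'I_n := Ordinal (ltnW n_gt1); pose j1 : 'I_n := Ordinal n_gt1.
pose S (p : 'I_Np * 'I_n) := f p.1 * 'X_(p.2).
pose w (i : 'I_Np + 'I_Nm) := match i with inl i => f i | inr i => g i end.
pose H (i : 'I_Nm * 'I_n + 'I_N) :=
  match i with inl p => g p.1 * 'X_(p.2) | inr i => h i end.
have spanH i : exists c, H i = \sum_p c p *: S p.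
  (* The negative part is moved to the other side, so that a sum of squares stands on each side. *)
  move: i; apply: span_of_sqnorm_eq; apply: polarization_coeff => z.
  have SE N' (u : 'I_N' -> {mpoly C[n]}) : \sum_p `|(u p.1 * 'X_(p.2)).@[z]| ^+ 2 =
      (\sum_j `|(u j).@[z]| ^+ 2) * \sum_(k < n) `|z k| ^+ 2.
    rewrite mulr_suml; under [RHS]eq_bigr do rewrite mulr_sumr.
    rewrite pair_big /=; apply: eq_bigr => -[j k] _ /=.
    by rewrite mevalM mevalXU normrM exprMn.
  by rewrite big_sumType /= SE -fgh mulrBl !SE addrC subrK.
have spanS i k : exists c, w i * 'X_k = \sum_p c p *: S p.
  case: i => i /=; last exact: (spanH (inl (i, k))).
  exists (fun p => (p == (i, k))%:R); rewrite (bigD1 (i, k)) //= eqxx scale1r.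
  by rewrite big1 ?addr0 // => p /negbTE->; rewrite scale0r.
have w_free (a : _ -> C) : \sum_i a i *: w i = 0 -> forall i, a i = 0.
  rewrite big_sumType /= => /(fg_free (a \o inl) (a \o inr))[a1 a2].
  by case=> i; [exact: a1 | exact: a2].
have wX_free (a : _ -> C) : \sum_i a i *: (w i * 'X_j0) = 0 -> forall i, a i = 0.
  move=> E; apply: w_free; apply/mpolyP => m; rewrite mcoeff0.
  rewrite -(mcoeffMX _ U_(j0)%MM) mulr_suml.
  by under eq_bigr do rewrite -scalerAl; rewrite E mcoeff0.
have le_card : (#|{: 'I_Np * 'I_n}| <= #|{: 'I_Np + 'I_Nm}|)%N.
  by rewrite card_prod card_sum !card_ord.
have Sspan := span_exchange wX_free (fun i => spanS i j0) le_card.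
have w0 : forall i, w i = 0.
  apply: (@shift_stable_eq0 _ _ j0 j1) => // i.
  have [c cE] := spanS i j1; have [d dE] := fin_all_exists Sspan.
  exists (fun l => \sum_p c p * d p l); rewrite cE.
  under eq_bigr do rewrite dE scaler_sumr.
  rewrite exchange_big; apply: eq_bigr => l _; rewrite scaler_suml.
  by apply: eq_bigr => p _; rewrite scalerA.
have /card_gt0P[i _] : (0 < #|{: 'I_Np + 'I_Nm}|)%N by rewrite card_sum !card_ord.
have w_sum0 : \sum_l (1 : C) *: w l = 0.
  by rewrite big1 // => l _; rewrite w0 scaler0.
by have /eqP := w_free (fun=> 1) w_sum0 i; rewrite oner_eq0.
Qed.

(** * Diagonal polynomials supported in a box *)

Section Box.
Variables (n d : nat).
Local Notation box := {ffun 'I_n -> 'I_d.+1}.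
Local Notation bigbox := {ffun 'I_n -> 'I_d.+2}.

Definition on_boundary (a : box) := [exists i, (a i == ord0) || (a i == ord_max)].

Definition weight m (a : {ffun 'I_n -> 'I_m}) := (\sum_(i < n) i * a i)%N.

Definition positive_exponent (c : nat) (a : box) :=
  on_boundary a || (weight a == c %[mod n]).

(** The exponent of z_k z^a; the target box is one unit longer in each direction, so [inord] never
    falls back to its default. *)
Definition raise (a : box) (k : 'I_n) : bigbox := [ffun i => inord (a i + (i == k))].

Lemma raiseE a k i : raise a k i = (a i + (i == k))%N :> nat.
Proof.
rewrite ffunE inordK // ltnS; apply: leq_trans (ltn_ord (a i)).
by case: eqP; rewrite ?addn1 ?addn0.
Qed.

(** For n >= 2 these are the b such that every b - e_k lies in the box. *)
Definition inner (b : bigbox) := [forall i, 0 < b i < d.+1]%N.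

Definition lower (b : bigbox) (k : 'I_n) : box := [ffun i => inord (b i - (i == k))].

Lemma lowerE b k i : inner b -> lower b k i = (b i - (i == k))%N :> nat.
Proof.
move=> /forallP/(_ i)/andP[_ lt_b]; rewrite ffunE inordK //.
exact: leq_ltn_trans (leq_subr _ _) lt_b.
Qed.

Lemma raise_eq b k a : inner b -> (raise a k == b) = (a == lower b k).
Proof.
move=> b_inner; apply/eqP/eqP => [<-|->]; apply/ffunP => i; apply: val_inj.
  by rewrite ffunE /= raiseE addnK inordK.
rewrite /= raiseE lowerE // subnK //.
by have /forallP/(_ i)/andP[b_gt0 _] := b_inner; case: eqP.
Qed.

Lemma weight_lower b k : inner b -> (weight (lower b k) + k = weight b)%N.
Proof.
move=> b_inner; rewrite /weight (bigD1 k) //= [RHS](bigD1 k) //=.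
rewrite lowerE // eqxx -addnA [X in (_ + X)%N]addnC addnA; congr (_ + _)%N.
  have /forallP/(_ k)/andP[b_gt0 _] := b_inner.
  by rewrite -mulnSr subn1 prednK.
by apply: eq_bigr => i /negbTE neq_ik; rewrite lowerE // neq_ik subn0.
Qed.

(** Lowering the k-th entry lowers the weight by k, so k is chosen congruent to [weight b - c] mod
    n. *)
Lemma lower_positive c b : (c < n)%N -> inner b ->
  exists k, positive_exponent c (lower b k).
Proof.
move=> lt_cn b_inner; have n_gt0 : (0 < n)%N by apply: leq_ltn_trans lt_cn.
(* Adding n - c stands for subtracting c without truncation. *)
exists (Ordinal (ltn_pmod (weight b + (n - c)) n_gt0)); apply/orP; right.
set k := Ordinal _; rewrite -(eqn_modDr k) weight_lower //= -modnDmr modnDmr.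
rewrite modnDmr addnCA (subnKC (ltnW lt_cn)).
by rewrite modnDr.
Qed.

(** An entry of [raise a k] equal to 0 comes from a zero entry of [a], and one equal to d + 1 from
    an entry d. *)
Lemma raise_on_boundary a k : ~~ inner (raise a k) -> on_boundary a.
Proof.
rewrite negb_forall; case/fintype.existsP => i; rewrite raiseE => out.
apply/fintype.existsP; exists i.
rewrite -!val_eqE /=; have := ltn_ord (a i); move: out; case: (i == k); lia.
Qed.

Section Coefficients.
Variables (C : numDomainType) (c : nat).

(* The positive value only has to be a square that is at least [n - 1]. *)
Definition box_coef (a : box) : C := if positive_exponent c a then n%:R ^+ 2 else -1.

(** The coefficient of |z^b|^2 in the product of the diagonal polynomial and ||z||^2. *)
Definition raised_coef (b : bigbox) : C :=
  \sum_(p : box * 'I_n | raise p.1 p.2 == b) box_coef p.1.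

Lemma raised_coef_ge0 b : (c < n)%N -> 0 <= raised_coef b.
Proof.
move=> lt_cn; have [b_inner|b_outer] := boolP (inner b); last first.
  apply: sumr_ge0 => -[a k] /= /eqP raE.
  rewrite /box_coef /positive_exponent (@raise_on_boundary a k) ?raE //=.
  by rewrite exprn_ge0 ?ler0n.
have -> : raised_coef b = \sum_k box_coef (lower b k).
  rewrite /raised_coef -(pair_big_dep predT
    (fun a k => raise a k == b) (fun a _ => box_coef a)).
  rewrite (exchange_big_dep predT) //=; apply: eq_bigr => k _.
  by rewrite (eq_bigl _ _ (fun a => raise_eq k a b_inner)) big_pred1_eq.
have [k0 k0_pos] := lower_positive lt_cn b_inner.
rewrite (bigD1 k0) //= {1}/box_coef k0_pos.
(* At most n other terms remain, each at least -1, and n <= n^2. *)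
apply: (@le_trans _ _ (n%:R ^+ 2 + \sum_(k < n | k != k0) -1)).
  rewrite sumr_const mulNrn subr_ge0 -natrX ler_nat.
  apply: leq_trans (max_card _) _.
  by rewrite card_ord leq_pmulr // (leq_ltn_trans _ lt_cn).
apply/lerD/ler_sum => // k _; rewrite /box_coef; case: ifP => // _.
by apply: le_trans (exprn_ge0 2 (ler0n _ n)); rewrite oppr_le0 ler01.
Qed.

End Coefficients.
End Box.

(** * The example polynomial and its decomposition *)

Section Example.
Variables (C : numClosedFieldType) (n d c : nat).
Local Notation box := {ffun 'I_n -> 'I_d.+1}.

Definition box_mnm m (a : {ffun 'I_n -> 'I_m})  : 'X_{1..n} :=
  [multinom a i : nat | i < n].

Lemma box_mnm_inj m : injective (@box_mnm m).
Proof.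
move=> a b /mnmP ab; apply/ffunP => i; apply: val_inj.
by have := ab i; rewrite !mnmE.
Qed.

(** The exponent of z^a times its conjugate, that is, of |z^a|^2. *)
Definition box_mnm2 (a : box) : 'X_{1..n + n} :=
  [multinom match split k with inl i => a i | inr i => a i end : nat | k < n + n].

Definition sqnorm_mnm m (z : 'I_n -> C) (a : {ffun 'I_n -> 'I_m}) : C :=
  `|'X_[box_mnm a].@[z]| ^+ 2.

Lemma meval_box_mnm2 a (z : 'I_n -> C) :
  'X_[box_mnm2 a].@[zwpoint z (Num.conj \o z)] = sqnorm_mnm z a.
Proof.
rewrite /sqnorm_mnm normCK !mevalX rmorph_prod big_split_ord /=; congr (_ * _).
  by apply: eq_bigr => i _; rewrite /zwpoint !mnmE (unsplitK (inl i)).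
by apply: eq_bigr => i _; rewrite /zwpoint !mnmE (unsplitK (inr i)) rmorphXn.
Qed.

Lemma sqnorm_mnm_raise (z : 'I_n -> C) (a : box) k :
  sqnorm_mnm z a * `|z k| ^+ 2 = sqnorm_mnm z (raise a k).
Proof.
rewrite /sqnorm_mnm -exprMn -normrM; congr (`|_| ^+ 2).
rewrite -(mevalXU z k) -mevalM -mpolyXD; congr (_.@[_]); congr 'X_[_].
by apply/mnmP => i; rewrite mnmDE mnm1E !mnmE raiseE eq_sym.
Qed.

Definition positive_set : {set box} := [set a | positive_exponent c a].

Definition box_poly : {mpoly C[n + n]} := \sum_a box_coef C c a *: 'X_[box_mnm2 a].
(** The scalar n is the square root of the positive value of [box_coef]. *)
Definition pos_part (j : 'I_#|positive_set|) : {mpoly C[n]} :=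
  n%:R *: 'X_[box_mnm (enum_val j)].
Definition neg_part (j : 'I_#|~: positive_set|) : {mpoly C[n]} :=
  'X_[box_mnm (enum_val j)].
Definition raised_part (j : 'I_#|{ffun 'I_n -> 'I_d.+2}|) : {mpoly C[n]} :=
  sqrtC (raised_coef C c (enum_val j)) *: 'X_[box_mnm (enum_val j)].

Lemma meval_box_poly z :
  box_poly.@[zwpoint z (Num.conj \o z)] = \sum_(a : box) box_coef C c a * sqnorm_mnm z a.
Proof.
rewrite raddf_sum; apply: eq_bigr => a _ /=.
by rewrite mevalZ meval_box_mnm2.
Qed.

Lemma box_poly_signature z :
  \sum_(a : box) box_coef C c a * sqnorm_mnm z a =
  \sum_j `|(pos_part j).@[z]| ^+ 2 - \sum_j `|(neg_part j).@[z]| ^+ 2.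
Proof.
rewrite (bigID (mem positive_set)) /=; congr (_ + _).
  rewrite big_enum_val; apply: eq_bigr => j _.
  have := enum_valP j; rewrite inE /box_coef => ->.
  by rewrite mevalZ normrM exprMn normr_nat.
rewrite -sumrN (eq_bigl (mem (~: positive_set))); last by move=> a; rewrite !inE.
rewrite big_enum_val; apply: eq_bigr => j _.
have := enum_valP j; rewrite !inE /box_coef => /negbTE->.
by rewrite mulN1r.
Qed.

Lemma box_poly_mul_sqnorm z : (c < n)%N ->
  (\sum_(a : box) box_coef C c a * sqnorm_mnm z a) * (\sum_k `|z k| ^+ 2) =
  \sum_j `|(raised_part j).@[z]| ^+ 2.
Proof.
move=> lt_cn.
transitivity (\sum_(b : {ffun 'I_n -> 'I_d.+2}) raised_coef C c b * sqnorm_mnm z b).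
  rewrite mulr_suml; under eq_bigr do rewrite mulr_sumr.
  (* The terms of the product are indexed by pairs (a, k) and grouped by b = a + e_k. *)
  rewrite pair_big /= (partition_big (fun p => raise p.1 p.2) predT) //=.
  apply: eq_bigr => b _; rewrite /raised_coef mulr_suml.
  apply: eq_bigr => -[a k] /= /eqP <-.
  by rewrite -mulrA sqnorm_mnm_raise.
rewrite (reindex (@enum_val _ predT)) /=; last exact: onW_bij (enum_val_bij _).
apply: eq_bigr => j _; rewrite mevalZ normrM exprMn; congr (_ * _).
have b_ge0 := raised_coef_ge0 C (enum_val j) lt_cn.
by rewrite ger0_norm ?sqrtC_ge0 // sqrtCK.
Qed.

(** The two families are nonzero multiples of distinct monomials, so each scalar is isolated by one
    coefficient. *)
Lemma pos_neg_part_free (u : 'I_#|positive_set| -> C) (v : 'I_#|~: positive_set| -> C) :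
  (0 < n)%N ->
  \sum_j u j *: pos_part j + \sum_j v j *: neg_part j = 0 ->
  (forall j, u j = 0) /\ (forall j, v j = 0).
Proof.
move=> n_gt0 uv0.
have coefE (A : {set box}) (w : 'I_#|A| -> C) a :
    (\sum_j w j *: 'X_[box_mnm (enum_val j)])@_(box_mnm a) =
    \sum_j w j * (enum_val j == a)%:R.
  rewrite raddf_sum /=; apply: eq_bigr => j _.
  by rewrite mcoeffZ mcoeffX (inj_eq (@box_mnm_inj _)).
have coefA (A : {set box}) (w : 'I_#|A| -> C) i :
    (\sum_j w j *: 'X_[box_mnm (enum_val j)])@_(box_mnm (enum_val i)) = w i.
  rewrite coefE (bigD1 i) //= eqxx mulr1 big1 ?addr0 // => j /negbTE neq.
  by rewrite (inj_eq enum_val_inj) neq mulr0.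
have coef0 (A : {set box}) (w : 'I_#|A| -> C) a : a \notin A ->
    (\sum_j w j *: 'X_[box_mnm (enum_val j)])@_(box_mnm a) = 0.
  move=> aA; rewrite coefE big1 // => j _.
  by case: eqP aA (enum_valP j) => [-> /negbTE->|]; rewrite ?mulr0.
rewrite (eq_bigr _ (fun j _ => scalerA _ _ _)) in uv0.
have n_neq0 : n%:R != 0 :> C by rewrite pnatr_eq0 -lt0n.
split=> j; have := congr1 (mcoeff (box_mnm (enum_val j))) uv0; rewrite mcoeffD mcoeff0.
  rewrite coefA coef0 ?addr0; last by rewrite inE negbK enum_valP.
  by move/eqP; rewrite mulf_eq0 (negbTE n_neq0) orbF => /eqP.
by rewrite coefA coef0 ?add0r //; have := enum_valP j; rewrite inE.
Qed.

(** At the origin only the constant term survives; the zero exponent is on the boundary, so the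
    value is n^2. *)
Lemma box_poly_neq0 : (0 < n)%N ->
  box_poly.@[zwpoint (fun=> 0) (Num.conj \o fun=> 0)] != 0.
Proof.
move=> n_gt0; rewrite meval_box_poly (bigD1 [ffun=> ord0]) //= big1 => [|a a_neq0].
  rewrite addr0 /box_coef /positive_exponent.
  have -> : on_boundary ([ffun=> ord0] : box).
    by apply/fintype.existsP; exists (Ordinal n_gt0); rewrite ffunE eqxx.
  rewrite /sqnorm_mnm mevalX big1 => [|i _]; last by rewrite mnmE ffunE expr0.
  by rewrite normr1 expr1n mulr1 expf_neq0 // pnatr_eq0 -lt0n.
have [i ai] : exists i, a i != ord0.
  apply/fintype.existsP; apply: contraNT a_neq0; rewrite negb_exists => /forallP a0.
  by apply/eqP/ffunP => i; rewrite ffunE; apply/eqP; have := a0 i; rewrite negbK.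
rewrite /sqnorm_mnm mevalX (bigD1 i) //= mnmE expr0n.
by rewrite [_ == 0%N](negbTE ai) mul0r normr0 expr0n mulr0.
Qed.
End Example.

(** * Counting boundary and positive exponents *)

Section Count.
Local Open Scope nat_scope.

Lemma expn_add2_le a n : (a.+2 ^ n.+1 <= a ^ n.+1 + 2 * n.+1 * a.+2 ^ n)%N.
Proof.
elim: n => [|n IHn]; first by rewrite !expn1 expn0; lia.
have XE : a.+2 ^ n.+1 = a.+2 * a.+2 ^ n by rewrite expnS.
rewrite expnS [a ^ n.+2]expnS.
move: (a.+2 ^ n) (a.+2 ^ n.+1) (a ^ n.+1) XE IHn => x X y XE IHn; nia.
Qed.

Variables (n d : nat).
Local Notation box := {ffun 'I_n -> 'I_d.+3}.

Definition boundary : {set box} := [set a | on_boundary a].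

(** Removing the two extreme values in each direction leaves an interior of side d + 1 in a box of
    side d + 3, so the boundary is a fraction of at most 2n / (d + 3). *)
Lemma card_boundary : #|boundary| * d.+3 <= 2 * n * d.+3 ^ n.
Proof.
have cardC : #|~: boundary| = d.+1 ^ n.
  pose inn : {pred 'I_d.+3} := predC (pred2 ord0 ord_max).
  have card_inn : #|inn| = d.+1.
    have := cardC (pred2 (ord0 : 'I_d.+3) ord_max).
    by rewrite card2 card_ord /= => -[].
  rewrite -[X in X ^ _]card_inn -[X in _ ^ X](card_ord n) -card_ffun_on.
  apply: eq_card => a.
  rewrite !inE negb_exists; apply/forallP/ffun_onP => a_in i; have := a_in i.
    by rewrite !inE.
  by rewrite !inE.
have := cardsC boundary; rewrite cardC card_ffun !card_ord; move: #|boundary| => B cardE.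
case: n cardE => [|m] cardE; first by rewrite !expn0 in cardE *; lia.
have le_B := expn_add2_le d.+1 m; rewrite -cardE addnC leq_add2l in le_B.
by rewrite expnS [d.+3 * _]mulnC mulnA leq_mul2r le_B orbT.
Qed.

(** Pigeonhole: the n residue classes of the weight partition the interior, so one of them has at
    most the average size. *)
Lemma positive_class : 0 < n -> exists2 c, c < n &
  n * #|positive_set n d.+2 c| <= n * #|boundary| + #|~: boundary|.
Proof.
move=> n_gt0; pose cls c := [set a in ~: boundary | weight a %% n == c].
have sum_cls : \sum_(c < n) #|cls c| = #|~: boundary|.
  rewrite -sum1_card.
  rewrite (partition_big (fun a => Ordinal (ltn_pmod (weight a) n_gt0)) predT) //=.
  apply: eq_bigr => k _; rewrite -sum1_card; apply: eq_bigl => a.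
  by rewrite !inE -val_eqE.
have [c le_c] : exists c : 'I_n, n * #|cls c| <= #|~: boundary|.
  apply/fintype.existsP; apply: contraT; rewrite negb_exists => /forallP gt_c.
  suff : n * #|~: boundary| < n * #|~: boundary| by rewrite ltnn.
  rewrite -{2}sum_cls big_distrr /= -{1}[n]card_ord -sum_nat_const.
  have k0 := Ordinal n_gt0.
  rewrite (bigD1 k0) //= [X in _ < X](bigD1 k0) //= -addSn leq_add //.
    by rewrite ltnNge gt_c.
  by apply: leq_sum => k _; rewrite ltnW // ltnNge gt_c.
exists c => //; apply: (@leq_trans (n * (#|boundary| + #|cls c|))); last first.
  by rewrite mulnDr leq_add2l.
rewrite leq_mul2l; apply/orP; right.
apply: leq_trans (leq_card_setU _ _); apply: subset_leq_card; apply/subsetP => a.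
rewrite !inE /positive_exponent (modn_small (ltn_ord c)).
by case: on_boundary.
Qed.
End Count.

(** * The two halves of the theorem *)

Lemma signature_bound (R : realType) (n : nat) (r : {mpoly R[i][n + n]}) (Np Nm : nat) :
  (1 < n)%N -> (exists z, bieval r z != 0) ->
  squared_norm (fun z => bieval r z * sqnorm z) ->
  signature_pair r Np Nm -> (Np + Nm < Np * n)%N.
Proof.
move=> n_gt1 [z0 rz0] [N [h hE]] [f [g [fg_free rE]]].
apply: (card_lt_of_mul_sqnorm n_gt1 _ fg_free (h := h)) => [|z].
  rewrite lt0n; apply: contra rz0; rewrite addn_eq0 => /andP[/eqP Np0 /eqP Nm0].
  rewrite rE; subst Np Nm; rewrite /sqnorm_poly /sqnorm !big_ord0 subrr //.
by have := hE z; rewrite rE.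
Qed.

Lemma signature_ratio_lt (R : realFieldType) (n Np Nm : nat) :
  (Np + Nm < Np * n)%N -> (0 < Np)%N /\ Nm%:R / Np%:R < n%:R - 1 :> R.
Proof.
move=> lt_N; have Np_gt0 : (0 < Np)%N by case: Np lt_N => //; rewrite mul0n.
split=> //; rewrite ltr_pdivrMr ?ltr0n //.
rewrite -(ltr_nat R) natrD natrM in lt_N; lra.
Qed.

Lemma box_poly_spec (R : realType) (n d c : nat) :
  (1 < n)%N -> (c < n)%N ->
  let r := box_poly R[i] n d c in
  [/\ real_polynomial r, (exists z, bieval r z != 0),
      squared_norm (fun z => bieval r z * sqnorm z) &
      signature_pair r #|positive_set n d c| #|~: positive_set n d c| ].
Proof.
move=> n_gt1 lt_cn r; have n_gt0 := ltnW n_gt1.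
have rE z : bieval r z =
    \sum_(a : {ffun 'I_n -> 'I_d.+1}) box_coef R[i] c a * sqnorm_mnm z a.
  exact: meval_box_poly.
split.
- move=> z; rewrite rE; apply: rpred_sum => a _; apply: rpredM.
    by rewrite /box_coef; case: ifP => _; rewrite ?rpredN ?rpredX ?realn ?rpred1.
  by rewrite rpredX // normr_real.
- by exists (fun=> 0); apply: box_poly_neq0.
- exists _, (@raised_part R[i] n d c) => z; rewrite rE; exact: box_poly_mul_sqnorm.
exists (@pos_part R[i] n d c), (@neg_part R[i] n d c).
split => [u v|z]; first exact: pos_neg_part_free.
by rewrite rE; exact: box_poly_signature.
Qed.

Theorem theorem1p1 (R : realType) (n : nat) (hn : (2 <= n)%N) :
  (forall (r : {mpoly R[i][n + n]}) (Np Nm : nat),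
     real_polynomial r ->
     (exists z, bieval r z != 0) ->
     squared_norm (fun z => bieval r z * sqnorm z) ->
     signature_pair r Np Nm ->
     (0 < Np)%N /\ Nm%:R / Np%:R < n%:R - 1 :> R)
  /\
  (forall eps : R, 0 < eps ->
     exists (r : {mpoly R[i][n + n]}) (Np Nm : nat),
       [/\ real_polynomial r,
           (exists z, bieval r z != 0),
           squared_norm (fun z => bieval r z * sqnorm z),
           signature_pair r Np Nm &
           (0 < Np)%N /\ n%:R - 1 - eps <= Nm%:R / Np%:R :> R]).
Proof.
split=> [r Np Nm _ r_neq0 r_sq r_sig|eps eps_gt0].
  exact/signature_ratio_lt/(signature_bound hn r_neq0 r_sq r_sig).
(* This size makes n times the boundary count at most [eps * Np], as shown in [le_nB]. *)
pose d := Num.bound (2 * n%:R ^+ 3 / eps).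
have [c lt_cn le_P] := positive_class d (ltnW hn).
have [r_real r_neq0 r_sq r_sig] := box_poly_spec R d.+2 hn lt_cn.
exists (box_poly R[i] n d.+2 c), #|positive_set n d.+2 c|, #|~: positive_set n d.+2 c|.
split=> //.
(* Part (i) applied to the example bounds the size N+ + N- of the box by n N+, which lets the
   boundary be compared with N+. *)
have lt_N := signature_bound hn r_neq0 r_sq r_sig.
have [Np_gt0 _] := signature_ratio_lt R lt_N; split=> //.
have le_B := card_boundary n d.
have d_gt : 2 * n%:R ^+ 3 < eps * d.+3%:R.
  rewrite [ltRHS]mulrC -ltr_pdivrMr //.
  apply: (@lt_trans _ _ d%:R); last by rewrite ltr_nat; lia.
  by apply: archi_boundP; rewrite divr_ge0 ?(ltW eps_gt0) // mulr_ge0 ?exprn_ge0 ?ler0n.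
have cardB := cardsC (boundary n d); have cardP := cardsC (positive_set n d.+2 c).
rewrite card_ffun !card_ord in cardB cardP.
move: le_P lt_N le_B cardB cardP Np_gt0 d_gt => {r_real r_neq0 r_sq r_sig}.
move: #|boundary n d| #|~: boundary n d| => B B'.
move: #|positive_set _ _ _| #|~: positive_set _ _ _| (_.+3 ^ n)%N => Np Nm T.
move: d.+3 => D.
rewrite -!(ltr_nat R) -!(ler_nat R) !(natrD, natrM).
move=> le_P lt_N le_B /(congr1 (fun x => x%:R : R)) + /(congr1 (fun x => x%:R : R)).
rewrite !natrD => cardB cardP Np_gt0 lt_D.
have D_gt0 : 0 < D%:R :> R.
  rewrite -(pmulr_rgt0 _ eps_gt0); apply: le_lt_trans lt_D.
  by rewrite mulr_ge0 ?exprn_ge0 ?ler0n.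
have le_T : n%:R ^+ 2 * T%:R <= n%:R ^+ 3 * Np%:R :> R.
  by rewrite [n%:R ^+ 3]exprSr -mulrA ler_wpM2l ?exprn_ge0 ?ler0n //; lra.
have le_nB : n%:R * B%:R <= eps * Np%:R.
  rewrite -(ler_pM2r D_gt0) -mulrA.
  apply: le_trans (_ : 2 * n%:R ^+ 3 * Np%:R <= _); last first.
    by rewrite [leRHS]mulrAC ler_wpM2r ?ler0n // ltW.
  apply: le_trans (ler_wpM2l (ler0n _ n) le_B) _.
  rewrite [leLHS](_ : _ = 2 * (n%:R ^+ 2 * T%:R)); last by ring.
  by rewrite -mulrA ler_wpM2l.
have B_ge0 : 0 <= B%:R :> R by apply: ler0n.
(* From [le_P] and the two cardinalities, N- >= (n - 1) N+ - n B + B, and n B is absorbed by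
   [le_nB]. *)
rewrite ler_pdivlMr //; lra.
Qed.
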